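(* Let $T$ be a tree with at least $3$ vertices. Then \[ Z_1(T)=2+\max_{v\in V(T)}\Bigg(\max_{\substack{S\subseteq T\\ v\in V(S)}}\Bigg(\min_{P\in\mathcal{P}_S(v)}\sum_{w\in V(P)}\big(\deg_S(w)-2\big)\Bigg)\Bigg), \] where $S$ ranges over the subtrees (connected subgraphs) of $T$ containing $v$.
   Context: Filling rule: if a filled vertex has exactly one unfilled neighbor (and any number of filled neighbors), that neighbor becomes filled; ''applying the filling rule in a subgraph $H$'' means applying it with neighborhoods taken in $H$. The $Z_q$-Game on $G$ ($q\ge 0$ an integer): initially all vertices are unfilled; a player repeatedly performs one of the following operations until all vertices are filled: (1) for one token, change any vertex from unfilled to filled; (2) at no cost, apply the filling rule in $G$; (3) if $F$ is the current set of filled vertices and $U_1,\dots,U_k$ are the vertex sets of the connected components of $G[V(G)\setminus F]$ with $k\ge q+1$, the player announces a selection of at least $q+1$ of the $U_i$ to an oracle (an adversary), the oracle returns a nonempty subset $\{U_{i_1},\dots,U_{i_\ell}\}$ of the selected components, and the player may at no cost apply the filling rule in $G[F\cup U_{i_1}\cup\cdots\cup U_{i_\ell}]$. $Z_q(G)$ is the minimum number of tokens with which the player can guarantee that all vertices become filled, regardless of the oracle's responses. For a subtree $S$ and $w\in V(S)$, $\deg_S(w)$ is the degree of $w$ in $S$. $\mathcal{P}_S(v)$ is the set of maximal paths in $S$ having $v$ as an endpoint (paths with endpoint $v$ not contained in a longer path with endpoint $v$; if $S$ is the single vertex $v$, this is the one-vertex path). *)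

(* Defs.v *)
From mathcomp Require Import all_boot all_order all_algebra.
Set Implicit Arguments. Unset Strict Implicit. Unset Printing Implicit Defensive.
Import Order.TTheory GRing.Theory Num.Theory.

(* A simple graph: vertex type T : finType, adjacency e : rel T, assumed
   symmetric and irreflexive in the theorem. *)

Section Defs.
Variable T : finType.
Implicit Types (e : rel T) (F S : {set T}).

Definition connected_graph e : Prop := forall x y : T, connect e x y.

Definition acyclic_graph e : Prop :=
  forall c : seq T, uniq c -> 3 <= size c -> ~~ cycle e c.

Definition is_tree e : Prop := connected_graph e /\ acyclic_graph e.

Definition induced_rel e S : rel T := fun a b => [&& e a b, a \in S & b \in S].

(* S (a vertex set) spans a connected subgraph; in a tree a connected subgraph
   is the induced subgraph on its vertex set *)
Definition is_subtree e S : Prop :=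
  S != set0 /\ {in S &, forall x y, connect (induced_rel e S) x y}.

Definition deg_in e S (w : T) : nat := #|[set u in S | e w u]|.

Definition vpath e S (v : T) (p : seq T) : bool :=
  [&& v \in S, path (fun a b => e a b && (b \in S)) v p & uniq (v :: p)].

(* maximal paths in S with endpoint v: not contained in a longer path with
   endpoint v (a path with endpoint v containing v :: p must extend it) *)
Definition maxpath e S (v : T) (p : seq T) : Prop :=
  vpath e S v p /\ ~ (exists q : seq T, q != [::] /\ vpath e S v (p ++ q)).

Definition pweight e S (v : T) (p : seq T) : int :=
  (\sum_(w <- v :: p) ((deg_in e S w)%:Z - 2))%R.

Definition is_min_over (A : seq T -> Prop) (f : seq T -> int) (m : int) : Prop :=
  (exists p, A p /\ f p = m) /\ (forall p, A p -> (m <= f p)%R).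

Definition maxmin_spec e (M : int) : Prop :=
  (exists (v : T) (S : {set T}), is_subtree e S /\ v \in S /\
       is_min_over (maxpath e S v) (pweight e S v) M) /\
  (forall (v : T) (S : {set T}), is_subtree e S -> v \in S ->
       exists m, is_min_over (maxpath e S v) (pweight e S v) m /\ (m <= M)%R).

Definition unf_rel e F : rel T := fun a b => [&& e a b, a \notin F & b \notin F].

Definition comps e F : {set {set T}} :=
  [set [set y | connect (unf_rel e F) x y] | x in ~: F].

(* win e q F k : from the position with filled set F, the player can guarantee
   (against every oracle) that all vertices get filled using at most k more tokens. *)
Inductive win e (q : nat) : {set T} -> nat -> Prop :=
| win_done F k : F = [set: T] -> win e q F k
| win_token F k x : x \notin F -> win e q (x |: F) k -> win e q F k.+1
| win_force F k x y :
    x \in F -> y \notin F -> e x y ->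
    (forall z, e x z -> z \notin F -> z = y) ->
    win e q (y |: F) k -> win e q F k
| win_oracle F k (Sel : {set {set T}}) :
    Sel \subset comps e F -> q < #|Sel| ->
    (forall R : {set {set T}}, R \subset Sel -> R != set0 ->
       exists x y, [/\ x \in F, y \in cover R, e x y,
         (forall z, e x z -> z \in F :|: cover R -> z \notin F -> z = y)
         & win e q (y |: F) k]) ->
    win e q F k.

Definition is_Zq e (q n : nat) : Prop :=
  win e q set0 n /\ (forall k, win e q set0 k -> n <= k).

End Defs.

(* Main.v *)
(* In a tree, write h(u, w) for the value obtained on the branch hanging at w
   away from u: if the children of w have values h_1 >= h_2 >= ..., then
   h(u, w) = max_k (k - 1 + h_k), and 0 if w has no child.  At a root v all
   neighbours count as children, and h(v, v) is the best value of the formula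
   over the subtrees S containing v, because retaining exactly the k highest
   children everywhere is optimal and the lightest path then loses nothing.

   The game costs at least every h(v, v).  Once the optimum is realized by
   k >= 2 completely unfilled branches at one vertex, the oracle either answers
   with a component away from them or with several of them at once, so only
   tokens enter these branches, and each token spoils at most one.

   Conversely, two components not attached to the same filled vertex always
   give a free step.  Otherwise all unfilled vertices form unfilled branches at
   a single filled vertex x, and the vertices of maximal value form a path going
   down from x; a token in the highest branch below the end of this path lowers
   all these values.  For the first token one needs a vertex y with
   h(y, y) < max_v h(v, v), found by walking towards the highest branches. *)
Require Import Defs.
From mathcomp Require Import all_boot all_order all_algebra.
From mathcomp Require Import zify.
Import Order.TTheory GRing.Theory Num.Theory.

Set Implicit Arguments. Unset Strict Implicit. Unset Printing Implicit Defensive.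

(** * Loads of families of heights *)

Section Loads.
Variable T : finType.
Implicit Types (f g : T -> nat) (A B C : {set T}).

(** This is the maximum over [k] of [k - 1] plus the [k]-th largest value of [f] on [A], written
    without sorting: the cardinal is the rank of [f c], ties counted in full. The empty set has load
    0. *)
Definition load f A : nat :=
  \max_(c in A) (f c + #|[set d in A | f c <= f d]|.-1).

Lemma eq_in_load f g A : {in A, f =1 g} -> load f A = load g A.
Proof.
move=> fg; apply: eq_bigr => c cA; rewrite fg //; congr (_ + _.-1).
by apply: eq_card => d; rewrite !inE; case dA: (d \in A) => //=; rewrite fg.
Qed.

Lemma load_ge f A C s :
  C \subset A -> C != set0 -> {in C, forall c, s <= f c} ->
  #|C|.-1 + s <= load f A.
Proof.
move=> CA /set0Pn[c0 c0C] sf.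
case: (arg_minnP f c0C) => c cC cmin.
have cA := subsetP CA _ cC.
rewrite addnC; apply: leq_trans (leq_bigmax_cond _ cA).
apply: leq_add; first exact: sf.
have CD : C \subset [set d in A | f c <= f d].
  by apply/subsetP => d dC; rewrite inE (subsetP CA _ dC) cmin.
by have := subset_leq_card CD; lia.
Qed.

Lemma load_ge_spread f A l : 0 < #|A| ->
  {in A, forall c, l <= #|A|.-1 + f c} -> l <= load f A.
Proof.
rewrite card_gt0 => A0 lA.
have : #|A|.-1 + (l - #|A|.-1) <= load f A by apply: load_ge => // c /lA; lia.
lia.
Qed.

Lemma load_witness f A : 0 < load f A ->
  exists2 c, c \in A & load f A = f c + #|[set d in A | f c <= f d]|.-1.
Proof.
move=> l0; have [A0|A0] := posnP #|A|.
  by move: l0; rewrite /load big_pred0 // => c; rewrite (cards0_eq A0) inE.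
by have [c cA E] := @eq_bigmax_cond T (mem A) (fun c => f c + #|[set d in A | f c <= f d]|.-1) A0; exists c.
Qed.

Lemma load_sub f A B : A \subset B -> load f A <= load f B.
Proof.
move=> AB; apply/bigmax_leqP => c cA; rewrite addnC; apply: load_ge.
- by apply/subsetP => d; rewrite inE => /andP[/(subsetP AB)].
- by apply/set0Pn; exists c; rewrite inE cA leqnn.
- by move=> d; rewrite inE => /andP[].
Qed.

Lemma le_load f A c : c \in A -> f c <= load f A.
Proof. by move=> cA; apply: leq_trans (leq_bigmax_cond _ cA); apply: leq_addr. Qed.

Lemma load_two f A c d k : c \in A -> d \in A -> c != d ->
  k <= f c -> k <= f d -> k < load f A.
Proof.
move=> cA dA cd kc kd; have <- : #|[set c; d]|.-1 + k = k.+1 by rewrite cards2 cd.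
apply: load_ge.
- by apply/subsetP => x /set2P[] ->.
- by apply/set0Pn; exists c; rewrite set21.
- by move=> x /set2P[] ->.
Qed.

(** Without a top element, the rank of every remaining value drops by exactly one. *)
Lemma load_rem_top f A c k : c \in A -> {in A, forall d, f d <= f c} ->
  load f A <= k.+1 -> load f (A :\ c) <= k.
Proof.
move=> cA ctop /bigmax_leqP Ak; apply/bigmax_leqP => d /setD1P[dc dA].
have := Ak d dA.
have -> : [set x in A | f d <= f x] = c |: [set x in A :\ c | f d <= f x].
  by apply/setP => x; rewrite !inE; have [->|//] := eqVneq x c; rewrite cA ctop.
rewrite cardsU1 !inE eqxx /=.
have : 0 < #|[set x in A :\ c | f d <= f x]|.
  by apply/card_gt0P; exists d; rewrite !inE dc dA leqnn.
lia.
Qed.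

(** [K] is an optimal family of children to retain; the heavy subtree is built from it. *)
Lemma load_subset f A : exists2 K : {set T}, K \subset A &
  (K = set0 /\ load f A = 0) \/
  (K != set0 /\ {in K, forall d, load f A <= #|K|.-1 + f d}).
Proof.
have [l0|l0] := posnP (load f A); first by exists set0; [exact: sub0set|left].
have [c cA ->] := load_witness l0.
exists [set d in A | f c <= f d].
  by apply/subsetP => d; rewrite inE => /andP[].
right; split; first by apply/set0Pn; exists c; rewrite inE cA leqnn.
by move=> d; rewrite inE addnC leq_add2l => /andP[].
Qed.

End Loads.

(** * Branches and heights in a tree *)

Section Tree.
Variables (T : finType) (e : rel T).
Hypotheses (esym : symmetric e) (eirr : irreflexive e) (htree : is_tree e).
Implicit Types (A F S U : {set T}) (u v w x y z c d : T).

Definition cut u w : rel T :=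
  fun a b => [&& e a b, (a, b) != (u, w) & (a, b) != (w, u)].

Lemma cut_intro u w a b :
  e a b -> ~ (a = u /\ b = w) -> ~ (a = w /\ b = u) -> cut u w a b.
Proof. by rewrite /cut => -> n1 n2 /=; apply/andP; split; apply/eqP => -[]; auto. Qed.

(* The side of [w] after deleting the edge [u w]; [branch v v] is the whole tree. *)
Definition branch u w : {set T} := [set x | connect (cut u w) w x].

(** These are the pairs at which branches are rooted: a directed edge, or [u = w] for the whole
    tree, where irreflexivity makes [kids v v] the set of all neighbours. *)
Definition arc u w := (u == w) || e u w.

Definition kids u w : {set T} := [set c | e w c & c != u].

Lemma branch_ind u w (P : T -> Prop) : P w ->
  (forall a b, a \in branch u w -> cut u w a b -> P a -> P b) ->
  forall x, x \in branch u w -> P x.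
Proof.
move=> Pw step x; rewrite inE => /connectP[p]; elim/last_ind: p x => [|p a IH] x /=.
  by move=> _ ->.
rewrite rcons_path last_rcons => /andP[pp lea] ->.
by apply: step lea (IH _ pp erefl); rewrite inE; apply/connectP; exists p.
Qed.

Lemma branch_root u w : w \in branch u w.
Proof. by rewrite inE connect0. Qed.

Lemma branch_step u w a b : a \in branch u w -> cut u w a b -> b \in branch u w.
Proof. by rewrite !inE => wa ab; apply: connect_trans wa (connect1 ab). Qed.

Lemma branch_enter u w x y :
  e x y -> x \notin branch u w -> y \in branch u w -> x = u /\ y = w.
Proof.
move=> xy xB yB; have [[-> ->]//|n1] := eqVneq (x, y) (u, w).
case/negP: (xB); apply: branch_step yB (cut_intro _ _ _); first by rewrite esym.
  by case=> _ xE; move: xB; rewrite xE branch_root.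
by case=> yE xE; rewrite xE yE eqxx in n1.
Qed.

(** Acyclicity enters here: a simple path from [w] to [u] avoiding the edge between them has at
    least three vertices, and that edge closes it to a cycle. *)
Lemma branch_parent u w : e u w -> u \notin branch u w.
Proof.
move=> uw; apply/negP; rewrite inE => /connectP[p0 pp0].
case/shortenP: pp0 => p pp up _ lp.
have ep : path e w p by apply: sub_path pp => a b /and3P[].
case: p lp pp ep up => [|a [|b p]] lp pp ep up.
- by move: uw; rewrite lp /= eirr.
- by move: pp; rewrite lp /= /cut eqxx !andbF.
have := htree.2 _ up erefl; rewrite /cycle rcons_path ep /=.
by move: lp => /= <-; rewrite uw.
Qed.

Lemma kids_arc u w c : c \in kids u w -> arc w c.
Proof. by rewrite inE /arc => /andP[-> _]; rewrite orbT. Qed.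

Lemma branch_kid_sub u w c : c \in kids u w -> branch w c \subset branch u w.
Proof.
rewrite inE => /andP[wc cu]; apply/subsetP; apply: branch_ind => [|a b aB ab aBu].
  apply: branch_step (branch_root u w) (cut_intro wc _ _) => -[_ E].
    by rewrite E eirr in wc.
  by rewrite E eqxx in cu.
have wB := branch_parent wc.
have bB := branch_step aB ab.
case/and3P: ab => ab _ _.
apply: branch_step aBu (cut_intro ab _ _) => -[E1 E2]; case/negP: wB.
  by rewrite -{1}E2.
by rewrite -{1}E1.
Qed.

Lemma branch_kid_lt u w c : c \in kids u w -> #|branch w c| < #|branch u w|.
Proof.
move=> ck; apply: proper_card; apply/properP; split; first exact: branch_kid_sub.
exists w; first exact: branch_root.
by apply: branch_parent; move: ck; rewrite inE => /andP[].
Qed.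

Lemma branch_kid u w z : z \in branch u w -> z != w ->
  exists2 c, c \in kids u w & z \in branch w c.
Proof.
move=> zB; suff [->|//] : z = w \/ (exists2 c, c \in kids u w & z \in branch w c).
  by rewrite eqxx.
elim/branch_ind: z / zB => [|a b aB ab IH]; first by left.
have [->|bw] := eqVneq b w; first by left.
right; case: IH => [aw|[c ck ac]].
  exists b; last exact: branch_root.
  rewrite aw in ab; case/and3P: ab => wb _ n; rewrite inE wb.
  by apply: contra n => /eqP ->.
exists c => //; apply/contraT => bB; case/and3P: ab => ab _ _.
by have [bw' _] := branch_enter (etrans (esym _ _) ab) bB ac; rewrite bw' eqxx in bw.
Qed.

Lemma branch_uniq v c d z : e v c -> e v d ->
  z \in branch v c -> z \in branch v d -> c = d.
Proof.
move=> vc vd zc zd; apply/eqP/contraT => cd.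
have : z \notin branch v c; last by rewrite zc.
elim/branch_ind: z / zd {zc} => [|a b aB ab aN].
  apply/negP => dB; case/negP: (branch_parent vc); apply: branch_step dB (cut_intro _ _ _).
  - by rewrite esym.
  - by case=> E1 _; rewrite E1 eirr in vd.
  - by case=> E1 _; rewrite E1 eqxx in cd.
apply/negP => bB; case/and3P: ab => ab _ _.
have [av _] := branch_enter ab aN bB.
by case/negP: (branch_parent vd); rewrite -{1}av.
Qed.

Lemma branch_full v z : z \in branch v v.
Proof.
have [vz|] := boolP (z \in branch v v) => // zN.
have /connectP[p pp lp] := htree.1 v z.
elim/last_ind: p z lp zN pp => [|p a IH] z /=; first by move=> ->; rewrite branch_root.
rewrite last_rcons rcons_path => -> aN /andP[pp la].
have [lB|lN] := boolP (last v p \in branch v v); last exact: (IH _ erefl lN pp).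
rewrite -(negbK (a \in _)) in aN; case/negP: aN; rewrite negbK.
by apply: branch_step lB (cut_intro la _ _) => -[E1 E2]; rewrite E1 E2 eirr in la.
Qed.

(** The recursion is on fuel [n]. Branches shrink strictly from parent to child, so [#|T|] units
    suffice and [heightE] recovers the recursive equation. *)
Fixpoint height_rec n u w : nat :=
  if n is m.+1 then load (height_rec m w) (kids u w) else 0.

Lemma height_rec_stable m n u w :
  #|branch u w| <= m -> #|branch u w| <= n -> height_rec m u w = height_rec n u w.
Proof.
have B0 a b : 0 < #|branch a b| by apply/card_gt0P; exists b; apply: branch_root.
elim: m n u w => [|m IH] [|n] u w; rewrite ?leqn0 ?(gtn_eqF (B0 _ _)) //= => Bm Bn.
apply: eq_in_load => c ck; have := branch_kid_lt ck => lt.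
by apply: IH; lia.
Qed.

Definition height := height_rec #|T|.

Lemma heightE u w : height u w = load (height w) (kids u w).
Proof.
by rewrite {1}/height (@height_rec_stable #|T| #|T|.+1) //; [|apply: leqW]; exact: max_card.
Qed.

Lemma height_kid u w c : c \in kids u w -> height w c <= height u w.
Proof. by rewrite (heightE u); apply: le_load. Qed.

Lemma branch_parent_out u w z d : arc u w -> z \in branch u w ->
  u \notin branch z d -> w \notin branch z d.
Proof.
move=> uw zB ud; apply/negP => wd.
case/orP: uw => [/eqP uw|uw]; first by rewrite uw wd in ud.
have [uz _] := branch_enter uw ud wd.
by case/negP: (branch_parent uw); rewrite {1}uz.
Qed.

(** Heights do not increase on the way down from [w] to [z], and at [z] only the branches pointing
    away from [u] are counted. This bounds the load at any vertex whose open branches avoid a filled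
    [u]. *)
Lemma height_branch u w z : arc u w -> z \in branch u w ->
  load (height z) [set d | e z d & u \notin branch z d] <= height u w.
Proof.
have [n] := ubnP #|branch u w|; elim: n u w => // n IH u w /ltnSE Bn uw zB.
have [->|zw] := eqVneq z w.
  rewrite heightE; apply: load_sub; apply/subsetP => d; rewrite in_set => /andP[wd ud].
  by rewrite inE wd; apply: contraNneq ud => ->; apply: branch_root.
have [c ck zc] := branch_kid zB zw.
apply: leq_trans (height_kid ck).
apply: leq_trans (IH _ _ (leq_trans (branch_kid_lt ck) Bn) (kids_arc ck) zc).
apply: load_sub; apply/subsetP => d; rewrite in_set => /andP[zd ud].
by rewrite in_set zd /=; apply: branch_parent_out ud.
Qed.


(** * Lower bound on the number of tokens *)

(** For nonempty [F], the largest load of [height v] on [open_kids F v] over all [v] is exactly the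
    number of tokens still needed, by [win_lower] and [win_upper]. *)
Definition open_kids F v : {set T} := [set c | e v c & [disjoint branch v c & F]].

Lemma open_kidsP F v c : c \in open_kids F v ->
  e v c /\ {in branch v c, forall z, z \notin F}.
Proof.
rewrite in_set => /andP[vc dis]; split=> // z zB.
by rewrite (disjointFr dis zB).
Qed.

Lemma open_kids_intro F v c : e v c -> {in branch v c, forall z, z \notin F} ->
  c \in open_kids F v.
Proof.
by move=> vc nF; rewrite in_set vc; apply/pred0P => z /=; apply/negP => /andP[/nF/negP].
Qed.

Lemma kids_open F v c : c \in open_kids F v -> kids v c \subset open_kids F c.
Proof.
move=> /open_kidsP[vc nF]; apply/subsetP => d dk; apply: open_kids_intro.
  by move: dk; rewrite inE => /andP[].
by move=> z /(subsetP (branch_kid_sub dk)) /nF.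
Qed.

(** The oracle can only protect branches that come at least in pairs. If a single branch realizes
    the load, its height is the load one level lower, so the search descends until two or more
    branches share it. *)
Lemma load_spread F v A : A \subset open_kids F v -> 0 < load (height v) A ->
  exists v' (A' : {set T}), [/\ A' \subset open_kids F v', 1 < #|A'| &
    {in A', forall c, load (height v) A <= #|A'|.-1 + height v' c}].
Proof.
have [n] : exists n, {in A, forall c, #|branch v c| <= n}.
  by exists #|T| => c _; exact: max_card.
elim: n v A => [|n IH] v A Bn AF l0; have [c cA E] := load_witness l0.
  by have := Bn c cA; rewrite leqn0 cards_eq0 => /eqP B0; have := branch_root v c; rewrite B0 inE.
set A' := [set d in A | _ <= _] in E.
have A'A : A' \subset A by apply/subsetP => d; rewrite inE => /andP[].
have [A'1|A'1] := ltnP 1 #|A'|.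
  exists v, A'; split=> //; first exact: subset_trans AF.
  by move=> d; rewrite inE E addnC leq_add2l => /andP[].
have EA : load (height v) A = load (height c) (kids v c).
  by rewrite E -heightE; lia.
rewrite EA in l0 *; apply: IH l0; last exact: kids_open (subsetP AF _ cA).
by move=> d dk; have := branch_kid_lt dk; have := Bn c cA; lia.
Qed.

(** * Components of the unfilled vertices *)

Lemma comps_notin F U a : U \in comps e F -> a \in U -> a \notin F.
Proof.
case/imsetP=> x; rewrite inE => xF ->; rewrite inE => /connectP[p].
by elim/last_ind: p a => [a _ ->//|p b _ a]; rewrite rcons_path last_rcons => /andP[_ /and3P[_ _ bF]] ->.
Qed.

Lemma comps_closed F U a b : U \in comps e F -> a \in U -> e a b -> b \notin F -> b \in U.
Proof.
move=> UF aU ab bF; have aF := comps_notin UF aU.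
case/imsetP: UF aU => x _ ->; rewrite !inE => xa; apply: connect_trans xa (connect1 _).
by rewrite /unf_rel ab aF.
Qed.

Lemma unf_sym F : connect_sym (unf_rel e F).
Proof. by apply: sym_connect_sym => a b; rewrite /unf_rel esym [(_ \notin _) && _]andbC. Qed.

Lemma comps_connect F U a b : U \in comps e F -> a \in U ->
  (b \in U) = connect (unf_rel e F) a b.
Proof.
case/imsetP=> x _ ->; rewrite !inE => xa.
by apply/idP/idP; [rewrite unf_sym in xa|]; apply: connect_trans.
Qed.

Lemma comps_eq F U U' a : U \in comps e F -> U' \in comps e F ->
  a \in U -> a \in U' -> U = U'.
Proof.
by move=> UF UF' aU aU'; apply/setP => b; rewrite (comps_connect b UF aU) (comps_connect b UF' aU').
Qed.

Lemma comps_ex F a : a \notin F -> exists2 U, U \in comps e F & a \in U.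
Proof.
move=> aF; exists [set y | connect (unf_rel e F) a y]; last by rewrite inE.
by apply/imsetP; exists a; rewrite ?inE.
Qed.

Lemma open_kid_comp F U v c z : U \in comps e F -> c \in open_kids F v ->
  z \in branch v c -> z \in U -> branch v c \subset U.
Proof.
move=> UF /open_kidsP[vc nF] zB zU.
have E x : x \in branch v c -> (x \in U) = (c \in U).
  move: x; apply: branch_ind => // a b aB ab <-.
  have bF := nF _ (branch_step aB ab); have aF := nF _ aB; case/and3P: ab => ab _ _.
  have ba : e b a by rewrite esym.
  by apply/idP/idP => xU; [apply: comps_closed UF xU ba aF|apply: comps_closed UF xU ab bF].
by apply/subsetP => x xB; rewrite E // -(E z).
Qed.

(* The generated principle gives no hypothesis under the oracle's answers. *)
Lemma win_nested_ind q (P : {set T} -> nat -> Prop) :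
  (forall k, P [set: T] k) ->
  (forall F k x, x \notin F -> P (x |: F) k -> P F k.+1) ->
  (forall F k x y, x \in F -> y \notin F -> e x y ->
     (forall z, e x z -> z \notin F -> z = y) -> P (y |: F) k -> P F k) ->
  (forall F k (Sel : {set {set T}}), Sel \subset comps e F -> q < #|Sel| ->
     (forall R : {set {set T}}, R \subset Sel -> R != set0 ->
       exists x y, [/\ x \in F, y \in cover R, e x y,
         (forall z, e x z -> z \in F :|: cover R -> z \notin F -> z = y)
         & P (y |: F) k]) -> P F k) ->
  forall F k, win e q F k -> P F k.
Proof.
move=> Pdone Ptoken Pforce Poracle; fix IH 3 => F k [].
- by move=> ? ? ->.
- by move=> ? ? x xF W; apply: Ptoken xF (IH _ _ W).
- by move=> ? ? x y xF yF xy u W; apply: Pforce xF yF xy u (IH _ _ W).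
move=> ? ? Sel SF qS H; apply: Poracle SF qS _ => R RS R0.
case: (H R RS R0) => x [y [xF yR xy u W]].
by exists x, y; split=> //; apply: IH W.
Qed.

Lemma open_kids_setU1 F v A y : A \subset open_kids F v ->
  {in A, forall c, y \notin branch v c} -> A \subset open_kids (y |: F) v.
Proof.
move=> AF yA; apply/subsetP => c cA; have [vc nF] := open_kidsP (subsetP AF _ cA).
apply: open_kids_intro => // z zB; rewrite in_setU1 negb_or nF // andbT.
by apply: contraNneq (yA _ cA) => <-.
Qed.

(** Branches at one vertex are disjoint, so a token spoils at most one of them. *)
Lemma open_kids_token F v A y : A \subset open_kids F v -> 1 < #|A| ->
  exists2 A' : {set T}, A' \subset open_kids (y |: F) v & A' \subset A /\ #|A|.-1 <= #|A'|.
Proof.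
move=> AF A1; have [/existsP[c /andP[cA yc]]|] := boolP [exists c in A, y \in branch v c].
  exists (A :\ c); last by split; [exact: subsetDl|rewrite (cardsD1 c A) cA].
  apply: open_kids_setU1 => [|d /setD1P[dc dA]]; first exact: subset_trans (subsetDl _ _) AF.
  apply: contraNN dc => yd; apply/eqP; apply: branch_uniq yd yc.
    by case: (open_kidsP (subsetP AF _ dA)).
  by case: (open_kidsP (subsetP AF _ cA)).
move=> yN; exists A; last by split; rewrite ?leq_pred.
apply: open_kids_setU1 => // c cA; apply: contraNN yN => yc.
by apply/existsP; exists c; rewrite cA.
Qed.

(* The oracle protects two or more entirely unfilled branches at [v]. *)
Lemma oracle_answer F v A (Sel : {set {set T}}) :
  A \subset open_kids F v -> 1 < #|A| -> Sel \subset comps e F -> 1 < #|Sel| ->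
  exists R : {set {set T}}, [/\ R \subset Sel, R != set0 &
    forall x y, x \in F -> y \in cover R -> e x y ->
      (forall z, e x z -> z \in F :|: cover R -> z \notin F -> z = y) ->
      {in A, forall c, y \notin branch v c}].
Proof.
move=> AF A1 SF S1.
have single U : U \in Sel -> {in A, forall c, [disjoint U & branch v c]} ->
    exists R : {set {set T}}, [/\ R \subset Sel, R != set0 &
    forall x y, x \in F -> y \in cover R -> e x y ->
      (forall z, e x z -> z \in F :|: cover R -> z \notin F -> z = y) ->
      {in A, forall c, y \notin branch v c}].
  move=> US dis; exists [set U]; split.
  - by rewrite sub1set.
  - by apply/set0Pn; exists U; rewrite set11.
  - move=> x y _; rewrite /cover big_set1 => yU _ _ c cA.
    by rewrite (disjointFr (dis _ cA) yU).
have [allS|] := boolP [forall U in Sel, exists c in A, ~~ [disjoint U & branch v c]]; last first.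
  rewrite negb_forall => /existsP[U]; rewrite negb_imply => /andP[US].
  rewrite negb_exists => /forallP dis; apply: (single U) => // c cA.
  by have := dis c; rewrite cA negbK.
have touch U : U \in Sel -> exists c, [/\ c \in A, branch v c \subset U & c \in U].
  move=> US; have /existsP[c /andP[cA]] := forall_inP allS U US.
  rewrite -setI_eq0 => /set0Pn[z /setIP[zU zB]].
  have BU := open_kid_comp (subsetP SF _ US) (subsetP AF _ cA) zB zU.
  by exists c; split=> //; apply: (subsetP BU); apply: branch_root.
(* Every selected component now meets a branch of [A]. If [v] is filled, the oracle returns the
   whole selection: a branch can be entered only from [v], which then sees unfilled neighbours in
   two components. *)
have [vF|vF] := boolP (v \in F).
  exists Sel; split=> //; first by rewrite -card_gt0; lia.
  move=> x y xF /bigcupP[U US yU] xy uniq_y c cA; apply/negP => yB.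
  have [vc nF] := open_kidsP (subsetP AF _ cA).
  have xB : x \notin branch v c by apply/negP => /nF; rewrite xF.
  have [xv yc] := branch_enter xy xB yB; subst x y.
  have /card_gt0P[U' /setD1P[U'U U'S]] : 0 < #|Sel :\ U|.
    by move: S1; rewrite (cardsD1 U) US.
  have [d [dA _ dU']] := touch U' U'S.
  have [vd dF] := open_kidsP (subsetP AF _ dA).
  have dc : d = c.
    apply: uniq_y => //; last by apply: dF; apply: branch_root.
    by rewrite inE; apply/orP; right; apply/bigcupP; exists U'.
  case/eqP: U'U; apply: comps_eq (dU') _; rewrite ?dc //; exact: (subsetP SF).
(* If [v] is unfilled, all branches of [A] lie in its component, so the selection would have just
   one element. *)
have [W WF vW] := comps_ex vF.
have AW c : c \in A -> c \in W.
  move=> cA; have [vc nF] := open_kidsP (subsetP AF _ cA).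
  by apply: comps_closed WF vW vc (nF _ (branch_root _ _)).
have SW U : U \in Sel -> U = W.
  move=> US; have [c [cA _ cU]] := touch U US.
  exact: comps_eq (subsetP SF _ US) WF cU (AW _ cA).
have : #|Sel| <= #|[set W]|; last by rewrite cards1 leqNgt S1.
by apply: subset_leq_card; apply/subsetP => U /SW ->; rewrite set11.
Qed.

Lemma win_lower F k : win e 1 F k ->
  forall v A, A \subset open_kids F v -> load (height v) A <= k.
Proof.
move: F k; apply: win_nested_ind => [k|F k x xF IH|F k x y xF yF xy u IH|F k Sel SF S1 H] v A AF.
- suff -> : A = set0 by rewrite /load big_set0.
  apply/eqP; rewrite -subset0; apply/subsetP => c /(subsetP AF) /open_kidsP[_ nF].
  by have := nF c (branch_root _ _); rewrite inE.
- have [->//|l0] := posnP (load (height v) A).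
  have [w [B [BF B1 lB]]] := load_spread AF l0.
  (* At most one branch of [B] is lost and the heights of the others are unchanged, so the load
     drops by at most one. *)
  have [B' B'F [B'B cB']] := open_kids_token x BF B1.
  have B'0 : B' != set0 by rewrite -card_gt0; lia.
  have : #|B'|.-1 + (load (height v) A - #|B|.-1) <= load (height w) B'.
    by apply: load_ge => // c /(subsetP B'B) /lB; lia.
  by have := IH w B' B'F; lia.
- have [->//|l0] := posnP (load (height v) A).
  have [w [B [BF B1 lB]]] := load_spread AF l0.
  apply: leq_trans (load_ge_spread _ lB) _; first lia.
  (* A force into a branch of [B] would start at [w], which has a second unfilled neighbour, the
     root of another branch of [B]. *)
  apply: IH; apply: open_kids_setU1 => // c cB; apply/negP => yB.
  have [wc nF] := open_kidsP (subsetP BF _ cB).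
  have xB : x \notin branch w c by apply/negP => /nF; rewrite xF.
  have [xw yc] := branch_enter xy xB yB; subst x y.
  have /card_gt0P[d /setD1P[dc dB]] : 0 < #|B :\ c|.
    by move: B1; rewrite (cardsD1 c) cB.
  have [wd dF] := open_kidsP (subsetP BF _ dB).
  by case/eqP: dc; apply: u => //; apply: dF; apply: branch_root.
have [->//|l0] := posnP (load (height v) A).
have [w [B [BF B1 lB]]] := load_spread AF l0.
have [R [RS R0 safe]] := oracle_answer BF B1 SF S1.
have [x [y [xF yR xy u IH]]] := H R RS R0.
apply: leq_trans (load_ge_spread _ lB) _; first lia.
by apply: IH; apply: open_kids_setU1 => //; apply: safe yR xy u.
Qed.

(** * The player's strategy *)

Lemma open_kids_sub F F' v : F \subset F' -> open_kids F' v \subset open_kids F v.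
Proof.
move=> FF'; apply/subsetP => c /open_kidsP[vc nF']; apply: open_kids_intro => // z /nF'.
by apply: contra; apply: (subsetP FF').
Qed.

(** Otherwise [U], which contains the root [c], would spread over the whole branch and contain
    [z]. *)
Lemma branch_exit F U v c z : U \in comps e F -> c \in U ->
  z \in branch v c -> z \in F ->
  exists x y, [/\ x \in F, x \in branch v c, y \in U & e x y].
Proof.
move=> UF cU zB zF.
have [/existsP[x /existsP[y /and4P[]]]|none] :=
  boolP [exists x, exists y, [&& x \in F, x \in branch v c, y \in U & e x y]].
  by exists x, y.
have : z \in U; last by move/(comps_notin UF); rewrite zF.
move: z zB {zF}; apply: branch_ind => // a b aB ab aU.
have bB := branch_step aB ab; case/and3P: ab => ab _ _.
apply: (comps_closed UF aU ab); apply: contra none => bF.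
by apply/existsP; exists b; apply/existsP; exists a; rewrite bF bB aU esym ab.
Qed.

Lemma comps_boundary F U : U \in comps e F -> F != set0 ->
  exists x y, [/\ x \in F, y \in U & e x y].
Proof.
move=> UF /set0Pn[z zF]; have : U != set0.
  by case/imsetP: UF => c _ ->; apply/set0Pn; exists c; rewrite inE connect0.
case/set0Pn=> c cU; have [x [y [xF _ yU xy]]] := branch_exit UF cU (branch_full c z) zF.
by exists x, y.
Qed.

Lemma comps_sub_branch F U x y z : U \in comps e F -> x \in F ->
  z \in U -> z \in branch x y -> U \subset branch x y.
Proof.
move=> UF xF zU zB; apply/subsetP => w; rewrite (comps_connect w UF zU) => zw.
rewrite -(closed_connect _ zw) //; apply: intro_closed; first exact: unf_sym.
move=> a b /and3P[ab aF bF] aB; apply: branch_step aB (cut_intro ab _ _) => -[E1 E2].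
  by rewrite E1 xF in aF.
by rewrite E2 xF in bF.
Qed.

Lemma comps_one_nbr F U x y z : U \in comps e F -> x \in F ->
  y \in U -> z \in U -> e x y -> e x z -> z = y.
Proof.
move=> UF xF yU zU xy xz; apply: branch_uniq xz xy (branch_root _ _) _.
exact: (subsetP (comps_sub_branch UF xF yU (branch_root _ _))).
Qed.

(* Follow the child of height [k + 1] as long as there is one, and fill the
   highest child of the vertex reached: every load equal to [k + 1] on this
   chain loses its highest branch. *)
Lemma token_choice v A k : {in A, forall c, e v c} -> A != set0 ->
  load (height v) A <= k.+1 ->
  exists y c0, [/\ c0 \in A, y \in branch v c0,
    load (height v) [set c in A | y \notin branch v c] <= k &
    forall c z, c \in A -> z \in branch v c ->
      load (height z) [set d | [&& e z d, v \notin branch z d & y \notin branch z d]] <= k].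
Proof.
have [n] : exists n, {in A, forall c, #|branch v c| <= n}.
  by exists #|T| => c _; exact: max_card.
elim: n v A => [|n IH] v A Bn vA /set0Pn[c0 c0A] lA.
  by have := Bn c0 c0A; rewrite leqn0 cards_eq0 => /eqP B0; have := branch_root v c0; rewrite B0 inE.
have [c cA cmax] := arg_maxnP (height v) c0A.
have drop y : y \in branch v c -> load (height v) [set d in A | y \notin branch v d] <= k.
  move=> yB; apply: leq_trans (load_rem_top cA cmax lA); apply: load_sub.
  apply/subsetP => d; rewrite in_set in_setD1 => /andP[dA yd]; rewrite dA andbT.
  by apply: contraNneq yd => ->.
have low y d z : d \in A -> height v d <= k -> z \in branch v d ->
    load (height z) [set d | [&& e z d, v \notin branch z d & y \notin branch z d]] <= k.
  move=> dA dk zB; have vd : arc v d by rewrite /arc vA ?orbT.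
  apply: leq_trans (leq_trans (height_branch vd zB) dk); apply: load_sub.
  by apply/subsetP => x; rewrite in_set => /and3P[zx vx _]; rewrite in_set zx.
have [ck|kc] := leqP (height v c) k.
  exists c, c; split=> //; first exact: branch_root.
    exact: drop (branch_root _ _).
  by move=> d z dA; apply: low => //; apply: leq_trans ck; apply: cmax.
have hE := heightE v c.
have hk : load (height c) (kids v c) <= k.+1.
  by rewrite -hE; apply: leq_trans lA; apply: le_load.
have k0 : kids v c != set0.
  by have [|d dk _] := @load_witness _ (height c) (kids v c); [lia|apply/set0Pn; exists d].
have Bk : {in kids v c, forall d, #|branch c d| <= n}.
  by move=> d dk; have := branch_kid_lt dk; have := Bn c cA; lia.
have ek : {in kids v c, forall d, e c d} by move=> d; rewrite inE => /andP[].
have [y [d0 [d0k yB yl yk]]] := IH c _ Bk ek k0 hk.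
have yBc : y \in branch v c by apply: (subsetP (branch_kid_sub d0k)).
exists y, c; split=> // [|d z dA]; first exact: drop.
have [->{d dA} zB|dc] := eqVneq d c; last first.
  apply: low => //; rewrite leqNgt; apply/negP => kd.
  by move: dc; rewrite eq_sym => dc; have := load_two cA dA dc kc kd; lia.
have [zc|zc] := eqVneq z c.
  rewrite zc; apply: leq_trans yl; apply: load_sub; apply/subsetP => d.
  rewrite in_set => /and3P[cd vd yd]; rewrite in_set yd [d \in kids _ _]in_set cd andbT /=.
  by apply: contraNneq vd => ->; apply: branch_root.
have [d dk zd] := branch_kid zB zc.
apply: leq_trans (yk d z dk zd); apply: load_sub; apply/subsetP => x.
rewrite in_set => /and3P[zx vx yx]; rewrite in_set zx yx andbT /=.
by apply: branch_parent_out vx => //; rewrite /arc vA ?orbT.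
Qed.

(** If the answer contains [U1], then [x] forces [y], having one neighbour in [U1] and none in [U2].
    Otherwise the answer is [U2] alone, and any filled vertex on its boundary forces. *)
Lemma oracle_step F k U1 U2 x y : F != set0 ->
  U1 \in comps e F -> U2 \in comps e F -> x \in F -> y \in U1 -> e x y ->
  {in U2, forall z, ~~ e x z} ->
  (forall z, z \notin F -> win e 1 (z |: F) k) -> win e 1 F k.
Proof.
move=> F0 U1F U2F xF yU1 xy xU2 next.
have U12 : U1 != U2 by apply: contraTneq xy => U12; apply: xU2; rewrite -U12.
apply: (win_oracle (Sel := [set U1; U2])).
- by apply/subsetP => U /set2P[] ->.
- by rewrite cards2 U12.
move=> R RS /set0Pn[U UR].
have covR z : z \in F :|: cover R -> z \notin F ->
    exists2 V, V \in R & z \in V /\ (V = U1 \/ V = U2).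
  rewrite inE => /orP[->//|/bigcupP[V VR zV]] _; exists V => //; split=> //.
  exact/set2P/(subsetP RS).
have [U1R|U1R] := boolP (U1 \in R).
  exists x, y; split=> //; first by apply/bigcupP; exists U1.
    move=> z xz zR zF; have [V VR [zV [VE|VE]]] := covR z zR zF; subst V.
      exact: comps_one_nbr U1F xF yU1 zV xy xz.
    by case/negP: (xU2 _ zV).
  exact/next/(comps_notin U1F).
have UE : U = U2.
  by have /set2P[UE|//] := subsetP RS _ UR; rewrite -UE UR in U1R.
rewrite {}UE in UR; have [x2 [y2 [x2F y2U xy2]]] := comps_boundary U2F F0.
exists x2, y2; split=> //; first by apply/bigcupP; exists U2.
  move=> z xz zR zF; have [V VR [zV [VE|VE]]] := covR z zR zF; subst V.
    by rewrite VR in U1R.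
  exact: comps_one_nbr U2F x2F y2U zV xy2 xz.
exact/next/(comps_notin U2F).
Qed.

(** A filled vertex inside the branch would yield a filled [x'] there, adjacent to the component of
    [c] and hence also to another component [U']. Then [U'] lies in that branch and touches [x], but
    [c] is the only neighbour of [x] there. *)
Lemma stuck_open_kids F x U1 U2 :
  (forall z U U', z \in F -> U \in comps e F -> U' \in comps e F ->
     (exists2 y, y \in U & e z y) -> exists2 y, y \in U' & e z y) ->
  U1 \in comps e F -> U2 \in comps e F -> U1 != U2 -> x \in F ->
  (exists2 y, y \in U1 & e x y) ->
  forall c, e x c -> c \notin F -> c \in open_kids F x.
Proof.
move=> adj U1F U2F U12 xF xU1 c xc cF; apply: open_kids_intro => // z zB.
have [U UF cU] := comps_ex cF.
have [U' U'F UU'] : exists2 U', U' \in comps e F & U != U'.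
  by have [->|] := eqVneq U U1; [exists U2|exists U1].
apply/negP => zF; have [x' [y' [x'F x'B y'U xy']]] := branch_exit UF cU zB zF.
have [y2 y2U' xy2] : exists2 y, y \in U' & e x' y by apply: adj UF U'F _ => //; exists y'.
have [c2 c2U' xc2] : exists2 y, y \in U' & e x y by apply: adj U1F U'F _.
have y2B : y2 \in branch x c.
  apply/contraT => y2B; have [y2x _] := branch_enter (etrans (esym _ _) xy2) y2B x'B.
  by have := comps_notin U'F y2U'; rewrite y2x xF.
have c2B := subsetP (comps_sub_branch U'F xF y2U' y2B) _ c2U'.
have cc2 := branch_uniq xc xc2 c2B (branch_root _ _).
by case/eqP: UU'; apply: (comps_eq UF U'F cU); rewrite cc2.
Qed.

Lemma win_upper F k : F != set0 ->
  (forall v, load (height v) (open_kids F v) <= k) -> win e 1 F k.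
Proof.
have [n] := ubnP #|~: F|; elim: n F k => // n IH F k /ltnSE Fn F0 Fk.
have next k' y : y \notin F -> (forall v, load (height v) (open_kids (y |: F) v) <= k') ->
    win e 1 (y |: F) k'.
  move=> yF; apply: IH; last by apply/set0Pn; exists y; rewrite setU11.
  have : #|~: F| <= n by [].
  by rewrite (cardsD1 y) inE yF setCU setIC -setDE; lia.
(* Filling a vertex never creates an open branch, so free moves preserve the bound. *)
have nextk y : y \notin F -> win e 1 (y |: F) k.
  move=> yF; apply: next => // v; apply: leq_trans (Fk v); apply: load_sub.
  exact: open_kids_sub (subsetUr _ _).
have [->|] := eqVneq F [set: T]; first exact: win_done.
rewrite -subTset => /subsetPn[y0 _ y0F]; have [U0 U0F yU0] := comps_ex y0F.
have [/existsP[x /andP[xF /existsP[U1 /andP[U1F /existsP[U2 /and3P[U2F]]]]]]|stuck] := boolP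
  [exists x in F, exists U1 in comps e F, exists U2 in comps e F,
    [exists y in U1, e x y] && ~~ [exists y in U2, e x y]].
  move=> /existsP[y /andP[yU1 xy]]; rewrite negb_exists => /forallP xU2.
  apply: (oracle_step F0 U1F U2F xF yU1 xy) => // z zU2.
  by have := xU2 z; rewrite zU2.
have adj z U U' : z \in F -> U \in comps e F -> U' \in comps e F ->
     (exists2 y, y \in U & e z y) -> exists2 y, y \in U' & e z y.
  move=> zF UF U'F [y yU zy]; apply/exists_inP; apply: contraR stuck => none.
  apply/existsP; exists z; rewrite zF /=; apply/existsP; exists U; rewrite UF /=.
  by apply/existsP; exists U'; rewrite U'F none andbT; apply/existsP; exists y; rewrite yU.
have [x [y [xF yU xy]]] := comps_boundary U0F F0.
(* With a single component left, any boundary vertex forces by the ordinary rule. *)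
have [/existsP[U2 /andP[U2F U20]]|single] := boolP [exists U in comps e F, U != U0]; last first.
  apply: (win_force xF (comps_notin U0F yU) xy) (nextk y (comps_notin U0F yU)) => z xz zF.
  have [U UF zU] := comps_ex zF; apply: comps_one_nbr U0F xF yU _ xy xz.
  apply: contraR single => zU0; apply/existsP; exists U; rewrite UF.
  by apply: contraNneq zU0 => <-.
rewrite eq_sym in U20.
have xU0 : exists2 y, y \in U0 & e x y by exists y.
have xopen := stuck_open_kids adj U0F U2F U20 xF xU0.
have cover z : z \notin F -> exists2 c, c \in open_kids F x & z \in branch x c.
  move=> zF; have [U UF zU] := comps_ex zF.
  have [c cU xc] := adj x U0 U xF U0F UF xU0.
  exists c; first exact: xopen xc (comps_notin UF cU).
  exact: (subsetP (comps_sub_branch UF xF cU (branch_root _ _))).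
have [c2 c2U xc2] := adj x U0 U2 xF U0F U2F xU0.
have yA := xopen y xy (comps_notin U0F yU).
have c2A := xopen c2 xc2 (comps_notin U2F c2U).
(* Two open branches at [x] already have load at least 1, so a token is available. *)
have : 0 < k.
  apply: leq_trans (Fk x); apply: load_two yA c2A _ (leq0n _) (leq0n _).
  by apply: contraNneq U20 => yc2; apply/eqP; apply: (comps_eq U0F U2F yU); rewrite yc2.
case: k Fk {nextk} => // k Fk _.
have [|| |t [c [cA tB tk1 tk2]]] := @token_choice x (open_kids F x) k.
- by move=> d /open_kidsP[].
- by apply/set0Pn; exists y.
- exact: Fk.
have tF : t \notin F by have [_ nF] := open_kidsP cA; apply: nF.
apply: (win_token tF) (next _ _ tF _) => v.
have sub := open_kids_sub v (subsetUr [set t] F).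
have kt d : d \in open_kids (t |: F) v -> t \notin branch v d.
  by case/open_kidsP=> _ nF; apply/negP => /nF; rewrite setU11.
have [vx|vx] := eqVneq v x.
  rewrite -vx in tk1; apply: leq_trans tk1; apply: load_sub; apply/subsetP => d dO.
  by rewrite in_set kt // andbT (subsetP sub).
have [/existsP[c' /andP[c'A vB]]|vN] := boolP [exists c in open_kids F x, v \in branch x c].
  apply: leq_trans (tk2 _ _ c'A vB); apply: load_sub; apply/subsetP => d dO.
  rewrite in_set kt // andbT; have [vd nF] := open_kidsP dO; rewrite vd /=.
  by apply/negP => /nF; rewrite in_setU1 xF orbT.
suff -> : open_kids (t |: F) v = set0 by rewrite /load big_set0.
apply/eqP; rewrite -subset0; apply/subsetP => d /(subsetP sub) /open_kidsP[vd nF].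
have [c' c'A dB] := cover d (nF _ (branch_root _ _)).
case/negP: vN; apply/existsP; exists c'; rewrite c'A /=; apply/contraT => vB.
by have [vx' _] := branch_enter vd vB dB; rewrite vx' eqxx in vx.
Qed.

(** * Choice of the first token *)

Lemma kids_self v c : (c \in kids v v) = e v c.
Proof. by rewrite inE; case vc: (e v c) => //=; apply: contraTneq vc => ->; rewrite eirr. Qed.

Lemma kids_sub_self u v : kids u v \subset kids v v.
Proof. by apply/subsetP => c; rewrite kids_self inE => /andP[]. Qed.

(** If [height b' b] reached [t], it would be realized by a family [D] of at least two neighbours of
    [b], all values being below [t]. Some member differs from [a], so [b'] is high enough to join
    [D], and the load at [b] would exceed [t]. *)
Lemma height_back t a b b' : b' \in kids a b ->
  {in kids a b, forall c, height b c <= height b b'} ->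
  {in kids b b, forall c, height b c < t} -> height b b <= t -> height b' b < t.
Proof.
move=> b'k top low; rewrite !heightE => bt; rewrite ltnNge; apply/negP => tb.
have b't := low _ (subsetP (kids_sub_self a b) _ b'k).
have [|c ck E] := @load_witness _ (height b) (kids b' b); first lia.
set D := [set d in _ | _ <= _] in E.
have ct := low _ (subsetP (kids_sub_self b' b) _ ck).
have DS d : d \in D -> [/\ d \in kids b b, d != b' & height b c <= height b d].
  rewrite inE => /andP[dk ->]; split=> //; first exact: (subsetP (kids_sub_self b' b)).
  by move: dk; rewrite inE => /andP[].
have /card_gt0P[d /setD1P[da dD]] : 0 < #|D :\ a|.
  by have := cardsD1 a D; case: (a \in D) => /=; lia.
have [dk _ cd] := DS _ dD.
have db' : height b d <= height b b'.
  by apply: top; move: dk; rewrite kids_self !inE da andbT.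
have : #|b' |: D|.-1 + height b c <= load (height b) (kids b b).
  apply: load_ge => [||x].
  - apply/subsetP => x /setU1P[->|/DS[]//].
    exact: (subsetP (kids_sub_self a b)).
  - by apply/set0Pn; exists b'; rewrite setU11.
  - by move=> /setU1P[->|/DS[]//]; apply: leq_trans cd db'.
have -> : #|b' |: D| = #|D|.+1.
  by rewrite cardsU1; case: (boolP (b' \in D)) => // /DS[_]; rewrite eqxx.
lia.
Qed.

(* Heading for the highest neighbour keeps the heights seen in both directions
   below [t], so the walk ends at a leaf that has this property. *)
Lemma low_vertex_walk t a b : (forall v, height v v <= t) -> e a b ->
  height a b < t -> height b a < t -> exists y, height y y < t.
Proof.
move=> ht; have [n] := ubnP #|branch a b|; elim: n a b => // n IH a b /ltnSE Bn ab hab hba.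
have [k0|/set0Pn[c0 c0k]] := eqVneq (kids a b) set0.
  (* Here [b] is a leaf, so its load is just [height b a]. *)
  exists b; rewrite heightE ltnNge; apply/negP => tb.
  have ka c : c \in kids b b -> c = a.
    rewrite kids_self => bc; apply/eqP/contraT => ca.
    by have := in_set0 c; rewrite -k0 inE bc ca.
  have [|c /ka -> E] := @load_witness _ (height b) (kids b b); first lia.
  have : #|[set d in kids b b | height b a <= height b d]| <= #|[set a]|.
    by apply: subset_leq_card; apply/subsetP => d; rewrite [d \in _]inE => /andP[/ka -> _]; rewrite set11.
  rewrite cards1; lia.
have [b' b'k top] := arg_maxnP (height b) c0k.
have low : {in kids b b, forall c, height b c < t}.
  move=> c; rewrite kids_self => bc; have [->//|ca] := eqVneq c a.
  by apply: leq_ltn_trans hab; apply: height_kid; rewrite inE bc.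
have bb' : e b b' by rewrite -kids_self (subsetP (kids_sub_self a b)).
apply: (IH b b') => //; first exact: leq_trans (branch_kid_lt b'k) Bn.
  by apply: low; rewrite kids_self.
exact: height_back b'k top low (ht b).
Qed.

(** If some branch has height at least [t], the walk starts at the root [b] of a smallest such
    branch: its children are below [t], and so is the branch back through [a], which could otherwise
    join the optimal family and push the load at [b] above [t]. *)
Lemma low_vertex t x y : (forall v, height v v <= t) -> e x y -> 0 < t ->
  exists z, height z z < t.
Proof.
move=> ht xy t0.
have [/existsP[a0 /existsP[b0 p0]]|none] :=
  boolP [exists a, exists b, e a b && (t <= height a b)]; last first.
  have low a b : e a b -> height a b < t.
    move=> ab; rewrite ltnNge; apply: contra none => tab.
    by apply/existsP; exists a; apply/existsP; exists b; rewrite ab.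
  by apply: (low_vertex_walk ht xy (low _ _ xy)); apply: low; rewrite esym.
have [[a b] /= /andP[ab tab] bmin] := @arg_minnP _ (a0, b0)
  [pred p | e p.1 p.2 & t <= height p.1 p.2] (fun p => #|branch p.1 p.2|) p0.
have lowk : {in kids a b, forall c, height b c < t}.
  move=> c ck; rewrite ltnNge; apply/negP => tc.
  have := bmin (b, c); rewrite /= tc andbT.
  have bc : e b c by move: ck; rewrite inE => /andP[].
  by move=> /(_ bc); have := branch_kid_lt ck; lia.
have [|c ck E] := @load_witness _ (height b) (kids a b); first by rewrite -heightE; lia.
set D := [set d in _ | _ <= _] in E.
have ct := lowk _ ck; have hE := heightE a b.
have cD : c \in D by rewrite inE ck leqnn.
have DS d : d \in D -> d \in kids a b /\ height b c <= height b d.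
  by rewrite inE => /andP[].
have ba : e b a by rewrite esym.
have hba : height b a < t.
  rewrite ltnNge; apply/negP => tba.
  have : #|a |: D|.-1 + height b c <= height b b.
    rewrite (heightE b b); apply: load_ge => [||d].
    - apply/subsetP => d /setU1P[->|/DS[dk _]]; first by rewrite kids_self.
      exact: (subsetP (kids_sub_self a b)).
    - by apply/set0Pn; exists a; rewrite setU11.
    - by move=> /setU1P[->|/DS[]//]; lia.
  have -> : #|a |: D| = #|D|.+1.
    by rewrite cardsU1; case: (boolP (a \in D)) => // /DS[]; rewrite inE eqxx andbF.
  have : 0 < #|D| by apply/card_gt0P; exists c.
  by have := ht b; lia.
have low : {in kids b b, forall d, height b d < t}.
  move=> d; rewrite kids_self => bd; have [->//|da] := eqVneq d a.
  by apply: lowk; rewrite inE bd.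
have [b' b'k top] := arg_maxnP (height b) ck.
have bb' : e b b' by rewrite -kids_self (subsetP (kids_sub_self a b)).
apply: (low_vertex_walk ht bb'); first exact: lowk.
exact: height_back b'k top low (ht b).
Qed.

Lemma win_first y k : height y y <= k -> win e 1 set0 k.+1.
Proof.
move=> yk; apply: (@win_token _ _ _ _ _ y); rewrite ?inE // setU0.
apply: win_upper => [|v]; first by apply/set0Pn; exists y; rewrite set11.
have yy : arc y y by rewrite /arc eqxx.
apply: leq_trans (leq_trans (height_branch yy (branch_full y v)) yk); apply: load_sub.
apply/subsetP => d /open_kidsP[vd nF]; rewrite in_set vd /=.
by apply/negP => /nF; rewrite set11.
Qed.

Lemma win_set0_lower k v : win e 1 set0 k -> height v v <= k.
Proof.
move=> W; rewrite heightE; apply: (win_lower W); apply/subsetP => c.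
by rewrite kids_self => vc; apply: open_kids_intro => // z _; rewrite inE.
Qed.

Lemma height_pos : 3 <= #|T| -> exists x y, e x y /\ 0 < height x x.
Proof.
move=> h3; have /card_gt0P[x _] : 0 < #|T| by lia.
have [y0 y0x] : exists y0, y0 != x.
  have /card_gt0P[y0 yx] : 0 < #|[set~ x]| by rewrite cardsC1; lia.
  by exists y0; move: yx; rewrite !inE.
have [y yk _] := branch_kid (branch_full x y0) y0x; rewrite kids_self in yk.
have [z zN] : exists z, z \notin [set x; y].
  have /card_gt0P[z zN] : 0 < #|~: [set x; y]|.
    by rewrite cardsCs setCK cards2 subn_gt0; apply: leq_trans h3; case: (x != y).
  by exists z; rewrite inE in zN.
move: zN; rewrite in_set2 negb_or => /andP[zx zy].
have [c ck zc] := branch_kid (branch_full x z) zx.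
have [cy|cy] := eqVneq c y; last first.
  exists x, y; split=> //; rewrite heightE; apply: load_two ck _ cy _ _ => //.
  by rewrite kids_self.
rewrite cy in zc; have [d dk _] := branch_kid zc zy.
exists y, x; split; first by rewrite esym.
rewrite heightE; apply: (@load_two _ _ _ d x) => //.
- exact: (subsetP (kids_sub_self x y)).
- by rewrite kids_self esym.
- by move: dk; rewrite inE => /andP[].
Qed.

(** * Weights of maximal paths *)

(** In a tree, simple paths from a root are those that always move to a child; this local form suits
    recursion on branches. [tip_kids] collects the one-vertex extensions, so it is empty exactly for
    maximal paths. *)
Fixpoint descends S u w (p : seq T) : bool :=
  if p is c :: q then [&& c \in kids u w, c \in S & descends S w c q] else true.

Fixpoint tip_kids S u w (p : seq T) : {set T} :=
  if p is c :: q then tip_kids S w c q else kids u w :&: S.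

Lemma descends_catl S u w p q : descends S u w (p ++ q) -> descends S u w p.
Proof. by elim: p u w => //= c p IH u w /and3P[-> -> /IH]. Qed.

Lemma descends_rcons S u w p c :
  descends S u w (rcons p c) = descends S u w p && (c \in tip_kids S u w p).
Proof. by elim: p u w => [|d p IH] u w /=; rewrite ?in_setI ?andbT // IH !andbA. Qed.

Lemma descends_branch S u w p :
  descends S u w p -> {subset w :: p <= branch u w}.
Proof.
elim: p u w => [|c p IH] u w /=; first by move=> _ x; rewrite mem_seq1 => /eqP ->; apply: branch_root.
case/and3P=> ck _ /IH sub x; rewrite inE => /orP[/eqP ->|/sub]; first exact: branch_root.
exact: (subsetP (branch_kid_sub ck)).
Qed.

Lemma descends_uniq S u w p : descends S u w p -> uniq (w :: p).
Proof.
elim: p u w => // c p IH u w /= /and3P[ck _ dp]; rewrite -/(uniq (c :: p)) (IH _ _ dp) andbT.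
have wc : e w c by move: ck; rewrite inE => /andP[].
by apply: contra (branch_parent wc); apply: (descends_branch dp).
Qed.

Lemma descends_path S u w p :
  descends S u w p -> path (fun a b => e a b && (b \in S)) w p.
Proof.
elim: p u w => // c p IH u w /= /and3P[]; rewrite inE => /andP[-> _] ->; exact: IH.
Qed.

Lemma vpath_descends S v p : vpath e S v p = (v \in S) && descends S v v p.
Proof.
rewrite /vpath; case: (v \in S) => //=; apply/idP/idP => [/andP[pp up]|dp]; last first.
  by rewrite (descends_path dp); apply: descends_uniq dp.
suff gen u : path (fun a b => e a b && (b \in S)) v p -> u \notin p ->
    uniq (v :: p) -> descends S u v p by apply: gen => //; case/andP: up.
elim: p u v {pp up} => // c p IH u v /= /andP[/andP[vc cS] pp].
rewrite inE negb_or eq_sym => /andP[cu up] /andP[]; rewrite inE negb_or => /andP[_ vp] ucp.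
by rewrite inE vc cu cS IH.
Qed.

Lemma maxpath_descends S v p : v \in S ->
  maxpath e S v p <-> descends S v v p /\ tip_kids S v v p = set0.
Proof.
move=> vS; rewrite /maxpath vpath_descends vS /=; split=> -[dp tip]; split=> //.
  apply/eqP; rewrite -subset0; apply/subsetP => c ct; case: tip.
  by exists [:: c]; rewrite vpath_descends vS cats1 descends_rcons dp ct.
case=> -[[]//|c q [_]]; rewrite vpath_descends vS -cat_rcons /= => /descends_catl.
by rewrite descends_rcons dp tip inE.
Qed.

Lemma deg_in_kids S u w : arc u w -> u \in S ->
  deg_in e S w = #|kids u w :&: S| + (u != w).
Proof.
move=> uw uS; rewrite /deg_in (cardsD1 u) inE uS /= addnC; congr (_ + _).
  by apply: eq_card => c; rewrite !inE; case: (c == u); case: (c \in S); rewrite ?andbF ?andbT.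
case/orP: uw => [/eqP ->|uw]; first by rewrite eirr eqxx.
by rewrite esym uw; case: eqVneq uw => // ->; rewrite eirr.
Qed.

Lemma pweight_cons S v c p :
  pweight e S v (c :: p) = ((deg_in e S v)%:Z - 2 + pweight e S c p)%R.
Proof. by rewrite /pweight big_cons. Qed.

Lemma pweight_nil S v : pweight e S v [::] = ((deg_in e S v)%:Z - 2)%R.
Proof. by rewrite /pweight big_seq1. Qed.

(** The path always enters the lowest child kept in [S]. With [m > 0] kept children, a vertex adds
    [m - 2], plus 1 for its parent edge; the term [u != w] accounts for that edge. *)
Lemma light_path S u w : arc u w -> u \in S -> w \in S ->
  exists p, [/\ descends S u w p, tip_kids S u w p = set0 &
    (pweight e S w p + 2 <= (height u w + (u != w))%:Z)%R].
Proof.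
have [n] := ubnP #|branch u w|; elim: n u w => // n IH u w /ltnSE Bn uw uS wS.
have dE := deg_in_kids uw uS.
have [K0|/set0Pn[c0 c0K]] := eqVneq (kids u w :&: S) set0.
  exists [::]; split=> //; rewrite pweight_nil dE K0 cards0; lia.
case: (arg_minnP (height w) c0K) => c cK cmin.
have [ck cS] := setIP cK.
have [p [dp tp wp]] := IH _ _ (leq_trans (branch_kid_lt ck) Bn) (kids_arc ck) wS cS.
exists (c :: p); split=> //=; first by rewrite ck cS.
have : #|kids u w :&: S|.-1 + height w c <= height u w.
  rewrite (heightE u); apply: load_ge => //; first exact: subsetIl.
  by apply/set0Pn; exists c.
have : 0 < #|kids u w :&: S| by apply/card_gt0P; exists c.
rewrite pweight_cons dE; case: (w != c) wp => /=; lia.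
Qed.

Lemma min_maxpath S v : v \in S ->
  exists m, is_min_over (maxpath e S v) (pweight e S v) m /\
    (m + 2 <= (height v v)%:Z)%R.
Proof.
move=> vS; have vv : arc v v by rewrite /arc eqxx.
have [p0 [dp0 tp0 wp0]] := light_path vv vS vS.
have short p : descends S v v p -> size p <= #|T|.
  move=> /descends_uniq /card_uniqP; rewrite /= => sz.
  by apply: leq_trans (leqnSn _) _; rewrite -sz; apply: max_card.
(* Simple paths have bounded length, so the minimum is taken over a finite type. *)
pose P (p : #|T|.-bseq T) := descends S v v p && (tip_kids S v v p == set0).
have Pp0 : P (Bseq (short _ dp0)) by rewrite /P /= dp0 tp0 eqxx.
have [p /andP[dp /eqP tp] pmin] := arg_minP (fun p : #|T|.-bseq T => pweight e S v p) Pp0.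
have min q : maxpath e S v q -> (pweight e S v p <= pweight e S v q)%R.
  case/(maxpath_descends _ vS) => dq tq.
  by apply: (pmin (Bseq (short _ dq))); rewrite /P /= dq tq eqxx.
exists (pweight e S v p); split; first split=> //.
  by exists p; split=> //; apply/maxpath_descends.
have : (pweight e S v p <= pweight e S v p0)%R by apply: min; apply/maxpath_descends.
by move: wp0; rewrite eqxx; lia.
Qed.

(** Exactly an optimal family [K] is retained at each vertex. Weights are measured in any [S'] that
    agrees with [S] on the branch and contains [u], because in the recursion a child's subtree sits
    in a larger one that contributes the parent edge to degrees. *)
Lemma heavy_subtree u w : arc u w -> exists S : {set T},
  [/\ w \in S, S \subset branch u w,
    {in S, forall x, connect (induced_rel e S) w x} &
    forall (S' : {set T}) p, S' :&: branch u w = S -> u \in S' ->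
      descends S' u w p -> tip_kids S' u w p = set0 ->
      ((height u w + (u != w))%:Z <= pweight e S' w p + 2)%R].
Proof.
have [n] := ubnP #|branch u w|; elim: n u w => // n IH u w /ltnSE Bn uw.
have [K Kk Kh] := load_subset (height w) (kids u w); rewrite -heightE in Kh.
have we d : d \in K -> e w d by move=> /(subsetP Kk); rewrite inE => /andP[].
(* Membership in [K] is a premise inside [good] so that one total function [f] can choose all the
   subtrees at once. *)
pose good d (S : {set T}) := d \in K -> [/\ d \in S, S \subset branch w d,
    {in S, forall x, connect (induced_rel e S) d x} &
    forall (S' : {set T}) p, S' :&: branch w d = S -> w \in S' ->
      descends S' w d p -> tip_kids S' w d p = set0 ->
      ((height w d + (w != d))%:Z <= pweight e S' d p + 2)%R].
have [f fP] : exists f : T -> {set T}, forall d, good d (f d).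
  apply: (@fin_all_exists _ (fun=> {set T}) good) => d.
  have [dK|dK] := boolP (d \in K); last by exists set0 => dK'; rewrite dK' in dK.
  have dk := subsetP Kk _ dK.
  by have [S SP] := IH _ _ (leq_trans (branch_kid_lt dk) Bn) (kids_arc dk); exists S.
pose S := w |: \bigcup_(d in K) f d.
have inS x d : d \in K -> x \in f d -> x \in S.
  by move=> dK xd; apply/setU1P; right; apply/bigcupP; exists d.
have Sw x : x \in S -> x = w \/ exists2 d, d \in K & x \in f d.
  by case/setU1P=> [->|/bigcupP[d dK xd]]; [left|right; exists d].
have wS : w \in S by rewrite setU11.
exists S; split=> //.
- apply/subsetP => x /Sw[->|[d dK xd]]; first exact: branch_root.
  have [_ fd _ _] := fP d dK.
  exact: (subsetP (branch_kid_sub (subsetP Kk _ dK)) _ (subsetP fd _ xd)).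
- move=> x /Sw[->|[d dK xd]]; first exact: connect0.
  have [dd _ conn _] := fP d dK; apply: (@connect_trans _ _ d).
    by apply: connect1; rewrite /induced_rel we // wS (inS _ _ dK dd).
  apply: connect_sub (conn _ xd) => a b /and3P[ab ad bd]; apply: connect1.
  by rewrite /induced_rel ab !(inS _ d).
move=> S' p S'S uS' dp tp.
have S'E x : x \in branch u w -> (x \in S') = (x \in S).
  by move=> xB; rewrite -S'S inE xB andbT.
have wS' : w \in S' by rewrite S'E // branch_root.
have S'f d : d \in K -> S' :&: branch w d = f d.
  move=> dK; have [dd fd _ _] := fP d dK.
  have sub := subsetP (branch_kid_sub (subsetP Kk _ dK)).
  apply/setP => x; rewrite in_setI; apply/andP/idP => [[xS' xd]|xf].
    have /Sw[xw|[d' d'K xd']] : x \in S by rewrite -S'E // sub.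
      by case/negP: (branch_parent (we _ dK)); rewrite -{1}xw.
    have [_ fd' _ _] := fP d' d'K.
    by rewrite (branch_uniq (we _ dK) (we _ d'K) xd (subsetP fd' _ xd')).
  by have xd := subsetP fd _ xf; rewrite S'E ?(inS _ d) // sub.
have KE : kids u w :&: S' = K.
  apply/setP => d; rewrite in_setI; apply/andP/idP => [[dk dS']|dK].
    have dB : d \in branch u w.
      by apply: (subsetP (branch_kid_sub dk)); apply: branch_root.
    have wd : e w d by move: dk; rewrite inE => /andP[].
    have /Sw[dw|[d' d'K dd']] : d \in S by rewrite -S'E.
      by rewrite dw eirr in wd.
    have [_ fd' _ _] := fP d' d'K.
    by rewrite (branch_uniq wd (we _ d'K) (branch_root _ _) (subsetP fd' _ dd')).
  have [dd _ _ _] := fP d dK; split; first exact: (subsetP Kk).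
  by move: dd; rewrite -S'f // => /setIP[].
have dE := deg_in_kids uw uS'; rewrite KE in dE.
(* A maximal path can stop at [w] only if [K] is empty, and then the height is 0. *)
case: p dp tp => [|d p] /=.
  rewrite KE => _ K0; case: Kh => [[_ h0]|[]]; last by rewrite K0 eqxx.
  by rewrite pweight_nil dE K0 cards0 h0; lia.
case/and3P=> dk dS' dp tp; have dK : d \in K by rewrite -KE inE dk.
have [_ _ _ heavy] := fP d dK; have := heavy S' p (S'f d dK) wS' dp tp.
have wd : w != d by apply: contraTneq (we _ dK) => <-; rewrite eirr.
case: Kh => [[K0]|[K0 /(_ d dK)]]; first by rewrite K0 inE in dK.
by rewrite pweight_cons dE wd -card_gt0 in K0 *; lia.
Qed.

Lemma heavy_subtree_root v : exists S : {set T}, [/\ is_subtree e S, v \in S &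
  forall p, maxpath e S v p -> ((height v v)%:Z <= pweight e S v p + 2)%R].
Proof.
have vv : arc v v by rewrite /arc eqxx.
have [S [vS _ conn heavy]] := heavy_subtree vv.
exists S; split=> //.
  split=> [|x y xS yS]; first by apply/set0Pn; exists v.
  have sym : connect_sym (induced_rel e S).
    by apply: sym_connect_sym => a b; rewrite /induced_rel esym [(_ \in _) && _]andbC.
  by apply: (connect_trans _ (conn y yS)); rewrite sym conn.
move=> p /(maxpath_descends _ vS)[dp tp]; have := heavy S p.
have -> : S :&: branch v v = S by apply/setIidPl/subsetP => x _; apply: branch_full.
by move=> /(_ erefl vS dp tp); rewrite eqxx addn0.
Qed.

End Tree.

Theorem theorem4p1 (T : finType) (e : rel T)
  (esym : symmetric e) (eirr : irreflexive e)
  (htree : is_tree e) (h3 : 3 <= #|T|) :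
  exists M : int, maxmin_spec e M /\
    exists z : nat, is_Zq e 1 z /\ (z%:Z = 2 + M)%R.
Proof.
have [x [y [xy hx]]] := height_pos esym eirr htree h3.
have [v _ vmax] := @arg_maxnP _ x predT (fun v => height e v v) isT.
have vx := vmax x isT; move: vmax vx.
set t := height e v v => vmax vx; exists (t%:Z - 2)%R; split; last first.
  exists t; split; last by lia.
  split; last by move=> k; apply: win_set0_lower.
  (* A first token at a vertex of height below [t] leaves a position that [t - 1] tokens win. *)
  have [z zt] : exists z, height e z z < t.
    by apply: (low_vertex esym eirr htree _ xy) => [w|]; [exact: vmax|lia].
  have -> : t = t.-1.+1 by lia.
  by apply: (win_first esym eirr htree (y := z)); lia.
split=> [|w S _ wS]; last first.
  have [m [mP mh]] := min_maxpath esym eirr htree wS; exists m; split=> //.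
  by have := vmax w isT => /=; lia.
have [S [tS vS heavy]] := heavy_subtree_root esym eirr htree v.
exists v, S; split=> //; split=> //.
have [m [mP mh]] := min_maxpath esym eirr htree vS.
(* [min_maxpath] bounds the minimum above by [t - 2], and the heavy subtree bounds it below. *)
suff -> : (t%:Z - 2)%R = m by [].
have [[p [pM pm]] _] := mP; have := heavy p pM; rewrite pm; lia.
Qed.
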